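(* Let $n\ge 2$ be an integer. If $F$ is a real algebraic number field of degree $n$ over $\mathbb{Q}$, then there exists an $F$-algebraic quasiperiodic flow $\phi$ on $T^n$ such that $\rho_\phi(S_\phi)=\mathfrak{o}_F^*$, i.e. the multiplier group of $\phi$ equals the group of units of the ring of integers of $F$.
   Context: Let $T^n=(\mathbb{R}/\mathbb{Z})^n$ be the $n$-torus ($n\ge 2$) with fixed global coordinates $(\theta_1,\dots,\theta_n)$, let $\mathrm{Diff}(T^n)$ be its group of $C^\infty$ diffeomorphisms, and let $\mathbb{R}^*=\mathbb{R}\setminus\{0\}$ be the multiplicative group of nonzero reals. A flow $\phi:\mathbb{R}\times T^n\to T^n$ is a smooth complete flow; its generating vector field is $X(p)=\frac{d}{dt}\phi(t,p)|_{t=0}$. It is nontrivial if $X$ is not identically zero. For $R\in\mathrm{Diff}(T^n)$, the push-forward is $R_*X=\mathbf{T}R\circ X\circ R^{-1}$, where $\mathbf{T}R$ is the tangent map. An $R\in\mathrm{Diff}(T^n)$ is a generalized symmetry of $\phi$ if there is $\alpha\in\mathbb{R}^*$ with $R_*X=\alpha X$; $\alpha$ is then a multiplier of $R$ (unique when $\phi$ is nontrivial). $S_\phi$ denotes the group of generalized symmetries of $\phi$. For nontrivial $\phi$, the homomorphism $\rho_\phi:S_\phi\to\mathbb{R}^*$ sends $R$ to its unique multiplier, and its image $\rho_\phi(S_\phi)=\{\alpha\in\mathbb{R}^* : R_*X=\alpha X\text{ for some }R\in\mathrm{Diff}(T^n)\}$ is the multiplier group of $\phi$. A flow generated by $X$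 is quasiperiodic if there are $V\in\mathrm{Diff}(T^n)$ and a constant vector field $Y$ whose $n$ real components are linearly independent over $\mathbb{Q}$ such that $V_*X=Y$. Quasiperiodic flows are nontrivial. A real algebraic number field of degree $n$ over $\mathbb{Q}$ is a subfield $F\subset\mathbb{R}$ with $\dim_{\mathbb{Q}}F=n$; a basis for $F$ means a basis of $F$ as a $\mathbb{Q}$-vector space. A quasiperiodic flow on $T^n$ generated by a constant vector field $\sum_{i=1}^n a_i\,\partial/\partial\theta_i$ ($a_i\in\mathbb{R}$) is called $F$-algebraic if there is $\vartheta\in\mathbb{R}^*$ such that $\{\vartheta a_1,\dots,\vartheta a_n\}$ is a basis for $F$ (so an $F$-algebraic flow is in particular generated by a constant vector field). $\mathfrak{o}_F$ is the ring of algebraic integers in $F$, and $\mathfrak{o}_F^*$ is its group of units. *)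

(* Defs.v *)
From HB Require Import structures.
From mathcomp Require Import all_boot all_order all_algebra.
From mathcomp Require Import generic_quotient ring_quotient.
From mathcomp Require Import all_classical all_reals all_analysis.

Set Implicit Arguments.
Unset Strict Implicit.
Unset Printing Implicit Defensive.

Import Order.TTheory GRing.Theory Num.Theory.
Import numFieldNormedType.Exports.

Local Open Scope classical_set_scope.
Local Open Scope ring_scope.
Local Open Scope quotient_scope.

(* In finite dimension, C^{k+1} means differentiable with every directional
   derivative of class C^k. *)
Fixpoint Ck_on (R : realType) (V W : normedModType R) (U : set V) (k : nat)
    (f : V -> W) : Prop :=
  if k is k'.+1 then
    (forall x, U x -> differentiable f x) /\
    (forall v, Ck_on U k' (fun x => 'd f x v))
  else forall x, U x -> {for x, continuous f}.

Definition smooth_near (R : realType) (V W : normedModType R) (f : V -> W)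
    (x : V) : Prop :=
  exists U : set V, [/\ open U, U x & forall k, Ck_on U k f].

(* T^n is the quotient group of R^n by the lattice Z^n of integer vectors. *)
Definition Zlattice (R : realType) (n : nat) : {pred 'rV[R]_n} :=
  fun x => x \is a mxOver Num.int.

Fact Zlattice_zmod_closed (R : realType) (n : nat) :
  zmod_closed (@Zlattice R n).
Proof.
split=> [|x y /mxOverP xZ /mxOverP yZ]; apply/mxOverP=> i j.
  by rewrite mxE rpred0.
by rewrite !mxE rpredB.
Qed.

HB.instance Definition _ (R : realType) (n : nat) :=
  GRing.isZmodClosed.Build 'rV[R]_n (@Zlattice R n)
    (@Zlattice_zmod_closed R n).

Notation torus R n := (Quotient.quot (@Zlattice R n)).

Definition torus_proj (R : realType) (n : nat) (x : 'rV[R]_n) : torus R n :=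
  \pi_(torus R n) x.

(* Representative modulo Z, in [-1/2, 1/2). *)
Definition centered (R : realType) (x : R) : R :=
  x - (Num.floor (x + 2^-1))%:~R.

(* The chart of T^n centered at p: [chart p q] is the representative of q - p
   in [-1/2, 1/2)^n.  It is a coordinate chart around p, where it is a local
   inverse of [fun v => p + torus_proj v]; these charts form the smooth
   atlas whose coordinate fields are the d/d theta_i.  Only its restriction to
   a neighbourhood of p is ever used, since it jumps on the cut locus. *)
Definition chart (R : realType) (n : nat) (p q : torus R n) : 'rV[R]_n :=
  map_mx (@centered R) (repr (q - p)).

Definition smooth_to_torus (R : realType) (n : nat) (V : normedModType R)
    (h : V -> torus R n) : Prop :=
  forall x, smooth_near (fun y => chart (h x) (h y)) x.

(* [torus_proj] is a local diffeomorphism, so a map from T^n is smooth iff its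
   composite with [torus_proj] is. *)
Definition smooth_torus_map (R : realType) (n : nat)
    (f : torus R n -> torus R n) : Prop :=
  smooth_to_torus (fun x => f (torus_proj x)).

Record torus_diffeo (R : realType) (n : nat) := TorusDiffeo {
  diffeo_fun :> torus R n -> torus R n;
  diffeo_inv : torus R n -> torus R n;
  diffeo_funK : cancel diffeo_fun diffeo_inv;
  diffeo_invK : cancel diffeo_inv diffeo_fun;
  diffeo_smooth : smooth_torus_map diffeo_fun;
  diffeo_inv_smooth : smooth_torus_map diffeo_inv }.

(* The coordinate fields d/d theta_i trivialize the tangent bundle, so tangent
   vectors are elements of R^n and vector fields are R^n-valued maps. *)
Definition tangent_map (R : realType) (n : nat) (f : torus R n -> torus R n)
    (p : torus R n) (v : 'rV[R]_n) : 'rV[R]_n :=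
  'd (fun w : 'rV[R]_n => chart (f p) (f (p + torus_proj w))) 0 v.

Definition push_forward (R : realType) (n : nat) (f : torus_diffeo R n)
    (X : torus R n -> 'rV[R]_n) : torus R n -> 'rV[R]_n :=
  fun q => tangent_map f (diffeo_inv f q) (X (diffeo_inv f q)).

Definition is_flow (R : realType) (n : nat) (phi : R -> torus R n -> torus R n)
    : Prop :=
  [/\ forall p, phi 0 p = p,
      forall s t p, phi (s + t) p = phi s (phi t p) &
      smooth_to_torus
        (fun tx : R * 'rV[R]_n => phi tx.1 (torus_proj tx.2))].

Definition generator (R : realType) (n : nat)
    (phi : R -> torus R n -> torus R n) (p : torus R n) : 'rV[R]_n :=
  derive1 (fun t : R => chart p (phi t p)) 0.

Definition is_multiplier (R : realType) (n : nat)
    (phi : R -> torus R n -> torus R n) (f : torus_diffeo R n) (alpha : R)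
    : Prop :=
  alpha != 0 /\
  forall p, push_forward f (generator phi) p = alpha *: generator phi p.

Definition generalized_symmetries (R : realType) (n : nat)
    (phi : R -> torus R n -> torus R n) : set (torus_diffeo R n) :=
  [set f | exists alpha, is_multiplier phi f alpha].

(* The multiplier of f, which is unique when f is a generalized symmetry of a
   nontrivial flow. *)
Definition rho (R : realType) (n : nat) (phi : R -> torus R n -> torus R n)
    (f : torus_diffeo R n) : R :=
  xget 0 [set alpha | is_multiplier phi f alpha].

Definition multiplier_group (R : realType) (n : nat)
    (phi : R -> torus R n -> torus R n) : set R :=
  rho phi @` generalized_symmetries phi.

Definition Qfree (R : realType) (n : nat) (a : 'I_n -> R) : Prop :=
  forall c : 'I_n -> rat, \sum_i ratr (c i) * a i = 0 -> forall i, c i = 0.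

Definition Qbasis (R : realType) (n : nat) (F : {pred R}) (a : 'I_n -> R)
    : Prop :=
  [/\ forall i, a i \in F, Qfree a &
      forall x, x \in F ->
        exists c : 'I_n -> rat, x = \sum_i ratr (c i) * a i].

Definition real_number_field (R : realType) (n : nat) (F : {pred R}) : Prop :=
  divring_closed F /\ exists a : 'I_n -> R, Qbasis F a.

Definition ring_of_integers (R : realType) (F : {pred R}) : set R :=
  [set x | x \in F /\ integralOver (intr : int -> R) x].

Definition unit_group (R : realType) (S : set R) : set R :=
  [set u | S u /\ exists2 v, S v & u * v = 1].

Definition quasiperiodic (R : realType) (n : nat)
    (phi : R -> torus R n -> torus R n) : Prop :=
  exists (f : torus_diffeo R n) (Y : 'rV[R]_n),
    Qfree (Y 0) /\ forall p, push_forward f (generator phi) p = Y.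

Definition F_algebraic (R : realType) (n : nat) (F : {pred R})
    (phi : R -> torus R n -> torus R n) : Prop :=
  quasiperiodic phi /\
  exists a : 'rV[R]_n,
    (forall p, generator phi p = a) /\
    exists2 theta : R, theta != 0 & Qbasis F (fun i => theta * a 0 i).

(* Main.v *)
Require Import Defs.
From HB Require Import structures.
From mathcomp Require Import all_boot all_order all_algebra all_field ring lra.
From mathcomp Require Import generic_quotient ring_quotient.
From mathcomp Require Import all_classical all_reals all_analysis.

(** Let [a] be a Z-basis of the ring of integers O of [F], and take the linear
    flow [p |-> p + t a] of the torus, whose generator is the constant field
    [a].

    Units are multipliers ([unit_multiplier]).  If [u] is a unit of O then
    [u a = a B] with [B] an invertible integer matrix, because multiplication by
    [u] maps O onto itself.  The automorphism of the torus induced by [B] has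
    tangent map [B], hence sends [a] to [u a].

    Multipliers are units ([flow_multiplier_integral]).  Let [f] be a
    diffeomorphism whose tangent map sends [a] to [alpha a] everywhere.  A lift
    of [f] to R^n maps the line [t a] to the line [t alpha a] (up to
    translation), and it stays within bounded distance of a linear map
    [x |-> x B] with [B] an integer matrix, namely the action of [f] on the
    fundamental group Z^n.  Letting [t] grow, [alpha a = a B]
    ([multiplier_integral_matrix]): [alpha] is an eigenvalue of an integer
    matrix, so it is an algebraic integer, and it is a quotient of elements of
    [F].  The same holds for the inverse diffeomorphism and [alpha^-1].

    The lift is built by hand.  The increment of [f] between two nearby points
    is well defined as a small vector of R^n, and by uniform continuity it is a
    cocycle at a fixed scale ([displacement_uniform]).  Summing it along a finely
    subdivided segment from 0 gives the lift ([primitiveB], [torus_map_lift]).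

    The existence of [a] ([integral_basis]) is the classical argument by the
    discriminant of the trace form: a basis of algebraic integers whose
    discriminant has least absolute value spans O. *)

Set Implicit Arguments.
Unset Strict Implicit.
Unset Printing Implicit Defensive.

Import Order.TTheory GRing.Theory Num.Theory.
Import numFieldNormedType.Exports.

Local Open Scope classical_set_scope.
Local Open Scope ring_scope.

(** * The sup norm on row vectors and the charts of the torus *)

Section RowNorm.
Context {R : realType}.

Lemma mx_entry_le m n (A : 'M[R]_(m, n)) i j : `|A i j| <= `|A|.
Proof.
rewrite [leRHS]/Num.Def.normr/= mx_normrE.
by apply: (le_trans _ (le_bigmax _ _ (i, j))).
Qed.

Lemma mx_norm_le m n (A : 'M[R]_(m, n)) e :
  0 <= e -> (forall i j, `|A i j| <= e) -> `|A| <= e.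
Proof. by move=> e0 Ae; rewrite [leLHS]/Num.Def.normr/= mx_normrE bigmax_le. Qed.

Lemma mulmx_norm_le m n p (A : 'M[R]_(m, n)) (B : 'M[R]_(n, p)) :
  `|A *m B| <= (\sum_k \sum_j `|B k j|) * `|A|.
Proof.
apply: mx_norm_le => [|i j].
  by rewrite mulr_ge0// sumr_ge0// => k _; rewrite sumr_ge0.
rewrite mxE mulr_suml (le_trans (ler_norm_sum _ _ _))// ler_sum// => k _.
rewrite normrM mulrC ler_pM// ?mx_entry_le//.
by rewrite (bigD1 j)//= lerDl sumr_ge0.
Qed.

Lemma linear_bound_continuous (V W : normedModType R) (f : {linear V -> W}) (K : R) :
  0 <= K -> (forall x, `|f x| <= K * `|x|) -> continuous f.
Proof.
move=> K0 fK x; apply/cvgrPdist_lt => e e0.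
have K1 : 0 < K + 1 by rewrite ltr_wpDl.
near=> y; rewrite -linearB (le_lt_trans (fK _))//.
rewrite (@le_lt_trans _ _ ((K + 1) * `|x - y|))//.
  by rewrite ler_wpM2r// lerDl.
rewrite -ltr_pdivlMl//; near: y; apply: cvgr_dist_lt; first exact: cvg_id.
by rewrite mulr_gt0// invr_gt0.
Unshelve. all: by end_near. Qed.

Lemma mulmxr_continuous m n p (B : 'M[R]_(n, p)) :
  continuous (mulmxr B : 'M[R]_(m, n) -> 'M[R]_(m, p)).
Proof.
apply: (@linear_bound_continuous _ _ _ (\sum_k \sum_j `|B k j|)) => [|A].
  by rewrite sumr_ge0// => k _; rewrite sumr_ge0.
exact: mulmx_norm_le.
Qed.
End RowNorm.

Section Torus.
Context {R : realType} {n : nat}.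
Implicit Types (x y u v w : 'rV[R]_n) (p q : torus R n).

Lemma torus_projD x y : torus_proj (x + y) = torus_proj x + torus_proj y.
Proof. exact: raddfD. Qed.

Lemma torus_projB x y : torus_proj (x - y) = torus_proj x - torus_proj y.
Proof. exact: raddfB. Qed.

Lemma torus_proj0 : torus_proj (0 : 'rV[R]_n) = 0.
Proof. exact: raddf0. Qed.

Lemma torus_projP x y :
  torus_proj x = torus_proj y <-> forall i, x 0 i - y 0 i \is a Num.int.
Proof.
rewrite /torus_proj; split=> [/eqP|xy].
  rewrite -Quotient.idealrBE => /mxOverP xy i.
  by have := xy 0 i; rewrite !mxE.
apply/eqP; rewrite -Quotient.idealrBE; apply/mxOverP => i j.
by rewrite ord1 !mxE.
Qed.

Lemma torus_reprK p : torus_proj (repr p) = p.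
Proof. exact: reprK. Qed.

Lemma centered_sub (x : R) : centered x - x \is a Num.int.
Proof. by rewrite /centered addrAC subrr add0r rpredN rpred_int. Qed.

Lemma centered_itv (x : R) : - 2^-1 <= centered x < 2^-1.
Proof.
have := floor_itv (x + 2^-1); rewrite /centered intrD => /andP[h1 h2].
apply/andP; split; [lra | ].
by rewrite ltrBlDr; move: h2; lra.
Qed.

Lemma int_lt1_eq0 (x : R) : x \is a Num.int -> `|x| < 1 -> x = 0.
Proof. by move=> xZ x1; apply: contraTeq x1 => x0; rewrite -leNgt norm_intr_ge1. Qed.

Lemma chart_proj_sub p q : torus_proj (chart p q) = q - p.
Proof.
rewrite -[RHS]torus_reprK; apply/torus_projP => i.
by rewrite mxE centered_sub.
Qed.

Lemma chart_norm_le p q : `|chart p q| <= 2^-1.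
Proof.
apply: mx_norm_le => // i j; rewrite mxE ler_norml.
by have /andP[-> /ltW ->] := centered_itv (repr (q - p) i j).
Qed.

(** A nonzero vector of Z^n has sup norm at least 1. *)
Lemma torus_proj_inj u v : torus_proj u = torus_proj v -> `|u - v| < 1 -> u = v.
Proof.
move=> /torus_projP uv uv1; apply/rowP => i; apply/eqP; rewrite -subr_eq0.
apply/eqP/int_lt1_eq0 => //; apply: le_lt_trans uv1.
by have := mx_entry_le (u - v) 0 i; rewrite !mxE.
Qed.

(** All computations in charts go through this characterization: the value of a
    chart is the only small vector that projects onto the difference. *)
Lemma chart_unique p q w : `|w| < 2^-1 -> q = p + torus_proj w -> chart p q = w.
Proof.
move=> w1 qE; apply: torus_proj_inj; first by rewrite chart_proj_sub qE addrC addKr.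
by rewrite (le_lt_trans (ler_normB _ _))// [ltRHS]splitr div1r ler_ltD// chart_norm_le.
Qed.

Lemma chart_refl p : chart p p = 0.
Proof. by apply: chart_unique; rewrite ?normr0// torus_proj0 addr0. Qed.

End Torus.

(** * Smooth maps and linear flows on the torus *)

(** The differential depends only on the germ.  A linear map of the torus
    read in charts is linear only near the base point, and two mutually inverse
    maps read in charts are inverse to each other only there. *)
Lemma near_eq_diff (R : numFieldType) (V W : normedModType R) (f g : V -> W) (x : V) :
  (\forall y \near x, f y = g y) -> differentiable f x ->
  differentiable g x /\ 'd g x = 'd f x :> (V -> W).
Proof.
move=> fg /diff_locallyP[df_cont /eqaddoP dfx].
have dgx : g \o shift x = cst (g x) + 'd f x +o_ 0 id.
  apply/eqaddoP => e /dfx; apply: filter_app; near=> h => /=.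
  suff -> : (g \o shift x - (cst (g x) + 'd f x)) h =
            (f \o shift x - (cst (f x) + 'd f x)) h by [].
  rewrite !fctE /= (nbhs_singleton fg); congr (_ - _); apply/esym.
  near: h; move: fg; rewrite (near_shift 0 x)/=.
  by apply: filterS => y /=; rewrite subr0.
have dE := diff_unique df_cont dgx; split => //.
by apply/diff_locallyP; split; [move=> y; rewrite dE | rewrite dE].
Unshelve. all: by end_near. Qed.

Section Smoothness.
Context {R : realType}.
Implicit Types V W : normedModType R.

Lemma Ck_on_eq V W (U : set V) (k : nat) (f g : V -> W) :
  open U -> (forall x, U x -> f x = g x) -> Ck_on U k f -> Ck_on U k g.
Proof.
move=> Uo; elim: k f g => [|k IH] f g fg /=.
  move=> fC x Ux; have := fC x Ux; rewrite /prop_for /continuous_at -fg//.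
  apply: cvg_trans; apply: near_eq_cvg.
  by apply: filterS (open_nbhs_nbhs (conj Uo Ux)) => y /fg.
have fgn x : U x -> \forall y \near x, f y = g y.
  by move=> Ux; apply: filterS (open_nbhs_nbhs (conj Uo Ux)) => y /fg.
move=> [fD fC]; split=> [x Ux|v]; first exact: (near_eq_diff (fgn x Ux) (fD x Ux)).1.
apply: IH (fC v) => x Ux.
have [_ dE] := @near_eq_diff R V W f g x (fgn x Ux) (fD x Ux).
exact: esym (congr1 (fun h => h v) dE).
Qed.

Lemma Ck_on_cst V W (U : set V) (k : nat) (c : W) : Ck_on U k (cst c : V -> W).
Proof.
elim: k c => [|k IH] c /=; first by move=> x _; apply: cvg_cst.
split=> [x _|v]; first exact: differentiable_cst.
rewrite (_ : (fun x => _) = cst 0); first exact: IH.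
by apply/funext => x; rewrite diff_cst.
Qed.

Lemma Ck_on_affine V W (U : set V) (k : nat) (L : {linear V -> W}) (c : W) :
  continuous L -> Ck_on U k (fun y => L y + c).
Proof.
move=> Lc.
have dL x := linear_differentiable x Lc.
case: k => [|k] /=; first by move=> x _; apply: cvgD; [exact: Lc|exact: cvg_cst].
split=> [x _|v]; first exact: differentiableD.
rewrite (_ : (fun x => _) = cst (L v)); first exact: Ck_on_cst.
by apply/funext => x; rewrite diffD//= diff_cst diff_lin//= addr0.
Qed.

Lemma smooth_to_torus_linear V n (L : {linear V -> 'rV[R]_n}) :
  continuous L -> smooth_to_torus (fun y => torus_proj (L y)).
Proof.
move=> Lc x.
have Uo : open [set y : V | `|L y - L x| < 2^-1].
  rewrite openE => y /= yx; rewrite /interior /=.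
  have /cvgr_norm_lt : (L z - L x) @[z --> y] --> L y - L x.
    by apply: cvgB; [exact: Lc|exact: cvg_cst].
  exact.
exists [set y : V | `|L y - L x| < 2^-1]; split => //=.
  by rewrite subrr normr0 invr_gt0.
move=> k; apply: Ck_on_eq (Ck_on_affine _ k (- L x) Lc) => // y yU.
by apply/esym/chart_unique => //; rewrite -torus_projD addrC subrK.
Qed.

Section TorusMaps.
Variable n : nat.
Implicit Types (p : torus R n) (v w a : 'rV[R]_n).

Lemma tangent_map_linear (f : torus R n -> torus R n) p (B : 'M[R]_n) v :
  (forall w, f (p + torus_proj w) = f p + torus_proj (w *m B)) ->
  tangent_map f p v = v *m B.
Proof.
move=> fB; rewrite /tangent_map.
have Bc : continuous (mulmxr B : 'rV[R]_n -> 'rV[R]_n) by exact: mulmxr_continuous.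
rewrite (near_eq_diff (f := mulmxr B) _ _).2 ?diff_lin//; last first.
  exact: linear_differentiable.
have : mulmxr B w @[w --> (0 : 'rV[R]_n)] --> mulmxr B (0 : 'rV[R]_n) by exact: Bc.
rewrite linear0 => /cvgr_norm_lt/(_ 2^-1).
rewrite normr0 invr_gt0 => /(_ (ltr0Sn _ _)); apply: filterS => w wB.
by apply/esym/chart_unique.
Qed.

Lemma is_derive_scalel a (s : R) : is_derive s 1 (fun t : R => t *: a) a.
Proof.
have da : differentiable (fun t : R => t *: a) s by exact: differentiableZl.
apply: DeriveDef; first exact: diff_derivable.
by rewrite deriveE// diffZl// diff_val scale1r.
Qed.

Definition linear_flow a (t : R) p : torus R n := p + torus_proj (t *: a).

Lemma linear_flow_is_flow a : is_flow (linear_flow a).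
Proof.
split=> [p|s t p|].
- by rewrite /linear_flow scale0r torus_proj0 addr0.
- by rewrite /linear_flow scalerDl torus_projD addrA addrAC.
pose V : normedModType R := (R * 'rV[R]_n)%type.
pose L (tx : V) : 'rV[R]_n := tx.2 + tx.1 *: a.
have Llin : linear L.
  by move=> k [t x] [s y]; rewrite /L /= scalerDr scalerDl scalerA addrACA.
pose LL : {linear V -> 'rV[R]_n} := HB.pack L (GRing.isLinear.Build _ _ _ _ _ Llin).
rewrite (_ : (fun _ => _) = (fun tx => torus_proj (LL tx))).
  apply: smooth_to_torus_linear => -[t x].
  by apply: cvgD; [exact: cvg_snd|apply: cvgZr_tmp; exact: cvg_fst].
by apply/funext => -[t x]; rewrite /linear_flow -torus_projD.
Qed.

Lemma generator_linear_flow a p : generator (linear_flow a) p = a.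
Proof.
rewrite /generator derive1E.
have aE : \forall t \near (0 : R), t *: a = chart p (linear_flow a t p).
  have : t *: a @[t --> (0 : R)] --> (0 : R) *: a by exact: cvgZr_tmp.
  rewrite scale0r => /cvgr_norm_lt/(_ 2^-1).
  rewrite normr0 invr_gt0 => /(_ (ltr0Sn _ _)); apply: filterS => t ta.
  by apply/esym/chart_unique.
rewrite -(near_eq_derive _ aE); exact: (@derive_val _ _ _ _ _ _ _ (is_derive_scalel a 0)).
Qed.

End TorusMaps.
End Smoothness.

(** * Primitives of local cocycles *)

(** A local additive cocycle on a normed space has a primitive.  [delta]
    is additive only over two consecutive steps shorter than [e]; summing it
    along the segment from 0 to [x], cut into pieces shorter than [e], gives a
    function of [x] whose increments it computes.  Applied to the
    displacement of a torus map this is the lifting of the map to R^n. *)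
Section Primitive.
Context {R : realType} {V W : normedModType R}.
Variables (delta : V -> V -> W) (e : R).
Hypothesis e_gt0 : 0 < e.
Hypothesis delta_cocycle : forall x y z, `|x - y| < e -> `|y - z| < e ->
  delta x y + delta y z = delta x z.

Let delta_diag x : delta x x = 0.
Proof.
by apply: (addrI (delta x x)); rewrite addr0 delta_cocycle// subrr normr0.
Qed.

Definition ray_sum (N : nat) (x : V) : W :=
  \sum_(0 <= k < N) delta ((k%:R / N%:R) *: x) ((k.+1%:R / N%:R) *: x).

Lemma ray_step N k (x : V) : (0 < N)%N -> `|x| < N%:R * e ->
  `|(k%:R / N%:R) *: x - (k.+1%:R / N%:R) *: x| < e.
Proof.
move=> N0 xN; rewrite -scalerBl -mulrBl.
rewrite -natr1 opprD addrA subrr add0r mulN1r normrZ normrN normfV.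
by rewrite normr_nat ltr_pdivrMl// ltr0n.
Qed.

Lemma ray_sum_primitive N (rho : R) (r : V -> W) (x : V) :
  (forall x y, `|x| < rho -> `|y| < rho -> `|x - y| < e ->
     delta x y = r y - r x) ->
  (0 < N)%N -> `|x| < N%:R * e -> `|x| < rho -> ray_sum N x = r x - r 0.
Proof.
move=> rP N0 xN xrho.
have ray_rho k : (k <= N)%N -> `|(k%:R / N%:R) *: x| < rho.
  move=> kN; apply: le_lt_trans xrho; rewrite normrZ ger0_norm ?divr_ge0//.
  by rewrite ler_piMl// ler_pdivrMr ?ltr0n// mul1r ler_nat.
rewrite /ray_sum (eq_big_nat _ _ (F2 := fun k =>
    r ((k.+1%:R / N%:R) *: x) - r ((k%:R / N%:R) *: x))); last first.
  by move=> k /andP[_ kN]; rewrite rP ?ray_rho ?ray_step// ltnW.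
rewrite (telescope_sumr (fun k => r ((k%:R / N%:R) *: x)))//.
by rewrite mul0r scale0r divff ?scale1r// pnatr_eq0 -lt0n.
Qed.

(** Moving the end point: each of the [N] thin quadrilaterals between the two
    rays splits into two triangles, to which the cocycle relation applies, and
    the short sides telescope. *)
Lemma ray_sumB N (x y : V) : (0 < N)%N ->
  `|x| < N%:R * e -> `|y| < N%:R * e -> `|x - y| < e ->
  delta x y = ray_sum N y - ray_sum N x.
Proof.
move=> N0 xN yN xy; rewrite /ray_sum -sumrB.
have short k : (k <= N)%N -> `|(k%:R / N%:R) *: x - (k%:R / N%:R) *: y| < e.
  move=> kN; apply: le_lt_trans xy; rewrite -scalerBr normrZ ger0_norm ?divr_ge0//.
  by rewrite ler_piMl// ler_pdivrMr ?ltr0n// mul1r ler_nat.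
pose g k := delta ((k%:R / N%:R) *: x) ((k%:R / N%:R) *: y).
rewrite (eq_big_nat _ _ (F2 := fun k => g k.+1 - g k)); last first.
  move=> k /andP[_ kN]; have kN' := ltnW kN.
  apply/eqP; rewrite subr_eq addrAC eq_sym subr_eq; apply/eqP.
  by rewrite addrC [RHS]addrC /g !delta_cocycle ?ray_step ?short.
rewrite telescope_sumr// /g mul0r !scale0r delta_diag subr0.
by rewrite divff ?scale1r// pnatr_eq0 -lt0n.
Qed.

Lemma ray_sum0 N : ray_sum N 0 = 0.
Proof. by rewrite /ray_sum big1// => k _; rewrite !scaler0 delta_diag. Qed.

(** The number of pieces is the least one that makes them shorter than [e];
    [primitive_ray_sum] says that any finer subdivision gives the same value. *)
Definition primitive (x : V) : W := ray_sum (Num.trunc (`|x| / e)).+1 x.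

Let trunc_bound (x : V) : `|x| < (Num.trunc (`|x| / e)).+1%:R * e.
Proof. by rewrite -ltr_pdivrMr// truncnS_gt. Qed.

Lemma primitive_ray_sum N (x : V) : (0 < N)%N -> `|x| < N%:R * e ->
  primitive x = ray_sum N x.
Proof.
move=> N0 xN; rewrite /primitive (@ray_sum_primitive _ (N%:R * e) (ray_sum N))//.
  by rewrite ray_sum0 subr0.
by move=> y z *; exact: ray_sumB.
Qed.

Lemma primitiveB (x y : V) : `|x - y| < e -> delta x y = primitive y - primitive x.
Proof.
move=> xy; pose N := maxn (Num.trunc (`|x| / e)).+1 (Num.trunc (`|y| / e)).+1.
have xN : `|x| < N%:R * e.
  by rewrite (lt_le_trans (trunc_bound x))// ler_pM2r// ler_nat leq_maxl.
have yN : `|y| < N%:R * e.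
  by rewrite (lt_le_trans (trunc_bound y))// ler_pM2r// ler_nat leq_maxr.
have N0 : (0 < N)%N by rewrite leq_max.
by rewrite !(@primitive_ray_sum N)//; exact: ray_sumB.
Qed.

Lemma primitive0 : primitive 0 = 0.
Proof. exact: ray_sum0. Qed.

Lemma primitive_bounded (c rho : R) : (forall x y, `|delta x y| <= c) ->
  exists M, forall x, `|x| <= rho -> `|primitive x| <= M.
Proof.
move=> dc; pose N := (Num.trunc (rho / e)).+1.
exists (\sum_(0 <= k < N) c) => x xrho.
rewrite (@primitive_ray_sum N)//; last first.
  by rewrite (le_lt_trans xrho)// -ltr_pdivrMr// truncnS_gt.
by rewrite (le_trans (ler_norm_sum _ _ _))// ler_sum.
Qed.

End Primitive.

(** [g] is a primitive of the zero cocycle, whose sum along a ray vanishes. *)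
Lemma uniformly_locally_constant (R : realType) (V W : normedModType R)
    (e : R) (g : V -> W) :
  0 < e -> (forall x y, `|x - y| < e -> g x = g y) -> forall x, g x = g 0.
Proof.
move=> e0 gC x; apply/eqP; rewrite -subr_eq0; apply/eqP.
have := @ray_sum_primitive R V W (fun _ _ => 0) e
  (Num.trunc (`|x| / e)).+1 (`|x| + 1) g x.
rewrite /ray_sum big1// => <- //; first by move=> y z _ _ /gC ->; rewrite subrr.
  by rewrite -ltr_pdivrMr// truncnS_gt.
by rewrite ltrDl.
Qed.

(** * Automorphisms of the torus and displacements of smooth maps *)

Section LinearMaps.
Context {R : realType} {n : nat}.
Implicit Types (x w : 'rV[R]_n) (p : torus R n) (B C : 'M[int]_n).

Definition int_mx m k (B : 'M[int]_(m, k)) : 'M[R]_(m, k) := map_mx intr B.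

Definition torus_linear B p : torus R n := torus_proj (repr p *m int_mx B).

Lemma torus_linear_proj B x : torus_linear B (torus_proj x) = torus_proj (x *m int_mx B).
Proof.
have /torus_projP xr := torus_reprK (torus_proj x).
apply/torus_projP => j; rewrite !mxE -sumrB rpred_sum// => k _.
by rewrite -mulrBl mxE rpredM ?rpred_int.
Qed.

Lemma torus_linear_shift B p w :
  torus_linear B (p + torus_proj w) = torus_linear B p + torus_proj (w *m int_mx B).
Proof.
rewrite -[p]torus_reprK -torus_projD !torus_linear_proj -torus_projD.
by rewrite mulmxDl.
Qed.

Lemma torus_linearK B C : B *m C = 1%:M -> cancel (torus_linear B) (torus_linear C).
Proof.
move=> BC p; rewrite [torus_linear B p]/torus_linear torus_linear_proj.
by rewrite -mulmxA -map_mxM BC map_mx1 mulmx1 torus_reprK.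
Qed.

Lemma torus_linear_smooth B : smooth_torus_map (torus_linear B).
Proof.
rewrite /smooth_torus_map (_ : (fun x => _) = (fun x => torus_proj (mulmxr (int_mx B) x))).
  apply: smooth_to_torus_linear; exact: mulmxr_continuous.
by apply/funext => x; rewrite torus_linear_proj.
Qed.

Definition torus_automorphism B C (BC : B *m C = 1%:M) (CB : C *m B = 1%:M) :
    torus_diffeo R n :=
  TorusDiffeo (torus_linearK BC) (torus_linearK CB)
    (torus_linear_smooth B) (torus_linear_smooth C).

Lemma push_forward_automorphism B C BC CB a q :
  push_forward (@torus_automorphism B C BC CB) (fun=> a) q = a *m int_mx B.
Proof. by apply: tangent_map_linear => w; rewrite /= torus_linear_shift. Qed.

End LinearMaps.

Section Differential.
Context {R : realType} {n : nat}.
Implicit Types (f g : torus R n -> torus R n) (x w a : 'rV[R]_n) (p : torus R n).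

(** This is the map that [tangent_map] differentiates. *)
Lemma local_map_differentiable f p : smooth_torus_map f ->
  differentiable (fun w => chart (f p) (f (p + torus_proj w))) 0.
Proof.
move=> fS; rewrite -[p]torus_reprK; set x := repr p.
have [U [_ Ux /(_ 1)[/(_ _ Ux) fx _]]] := fS x.
rewrite (_ : (fun w => _) =
    (fun y => chart (f (torus_proj x)) (f (torus_proj y))) \o (fun w => x + w)); last first.
  by apply/funext => w; rewrite /= torus_projD.
apply: differentiable_comp; last by rewrite addr0.
by apply: differentiableD.
Qed.

Lemma diff_local_inverse (V W : normedModType R) (F : V -> W) (G : W -> V) (v : V) :
  F 0 = 0 -> differentiable F 0 -> differentiable G 0 ->
  (\forall w \near 0, G (F w) = w) -> 'd G 0 ('d F 0 v) = v.
Proof.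
move=> F0 dF dG GF.
have dGF0 : differentiable G (F 0) by rewrite F0.
have := diff_comp dF dGF0; rewrite F0 => /(congr1 (@^~ v)) /= <-.
rewrite (near_eq_diff (f := id) _ _).2 ?diff_val//.
by apply: filterS GF => w /= ->.
Qed.

Lemma tangent_map_inverse f g p v : cancel f g ->
  smooth_torus_map f -> smooth_torus_map g ->
  tangent_map g (f p) (tangent_map f p v) = v.
Proof.
move=> fK fS gS; apply: diff_local_inverse.
- by rewrite torus_proj0 addr0 chart_refl.
- exact: local_map_differentiable.
- exact: local_map_differentiable.
have /cvgr_norm_lt/(_ 2^-1) : w @[w --> (0 : 'rV[R]_n)] --> (0 : 'rV[R]_n) by exact: cvg_id.
rewrite normr0 invr_gt0 => /(_ (ltr0Sn _ _)); apply: filterS => w w1.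
apply: chart_unique => //.
by rewrite chart_proj_sub addrC subrK !fK.
Qed.

(** The increment of a lift of [f] to R^n, as long as it stays below 1/2. *)
Definition displacement f x y := chart (f (torus_proj x)) (f (torus_proj y)).

(** Continuity gives a radius around each point of the unit cube, compactness a
    common one, and periodicity extends it to R^n. *)
Lemma displacement_uniform f : smooth_torus_map f ->
  exists2 e : R, 0 < e & forall x y, `|x - y| < e -> `|displacement f x y| < 4^-1.
Proof.
move=> fS.
pose P (e : R) x := forall z, `|x - z| < e -> `|displacement f x z| < 4^-1.
pose K := [set x : 'rV[R]_n | forall i, `[0, 1]%classic (x ord0 i)].
have Kc : compact K.
  exact: (@rV_compact R n (fun=> `[0, 1]%classic)
            (fun=> @segment_compact R 0 1)).
have : \forall e \near (0 : R)^'+, K `<=` P e.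
  have /compact_near_coveringP cov := Kc; apply: cov => x _.
  have [U [_ Ux /(_ 0) fC]] := fS x.
  have /cvgr_norm_lt/(_ 8^-1) := fC x Ux.
  rewrite chart_refl normr0 invr_gt0 => /(_ (ltr0Sn _ _)).
  move=> /nbhs_normP[eta /= eta0 small].
  have small' y : `|x - y| < eta -> `|displacement f x y| < 8^-1 by move=> ?; exact: small.
  near=> y e.
  have e_eta : e <= eta / 2 by near: e; apply: nbhs_right_le; rewrite divr_gt0.
  move=> z yz.
  have xy : `|x - y| < eta / 2.
    by near: y; apply: cvgr_dist_lt; [exact: cvg_id|rewrite divr_gt0].
  have xz : `|x - z| < eta.
    rewrite -(subrKA y) (le_lt_trans (ler_normD _ _))// [ltRHS]splitr ltrD//.
    exact: lt_le_trans yz e_eta.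
  (* both displacements start at x, so their difference is the one from y to z *)
  have bnd : `|displacement f x z - displacement f x y| < 4^-1.
    have h1 := small' _ xz.
    have h2 : `|displacement f x y| < 8^-1.
      by apply: small'; apply: (lt_trans xy); rewrite ltr_pdivrMr// ltr_pMr// ltr1n.
    by rewrite (le_lt_trans (ler_normB _ _))//; lra.
  rewrite {1}/displacement (chart_unique (w := displacement f x z - displacement f x y))//.
    by apply: (lt_trans bnd); rewrite ltf_pV2 ?posrE// ltr_nat.
  by rewrite torus_projB !chart_proj_sub opprB subrKA addrC subrK.
move=> Pnear; near (0 : R)^'+ => e.
exists e => // x y xy.
have KP : K `<=` P e by near: e.
pose k : 'rV[R]_n := \row_i (Num.floor (x 0 i))%:~R.
have periodic z : torus_proj (z - k) = torus_proj z.
  by apply/torus_projP => i; rewrite !mxE addrAC subrr add0r rpredN rpred_int.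
rewrite /displacement -(periodic x) -(periodic y); apply: KP.
  move=> i; rewrite /= in_itv/= !mxE.
  have := floor_itv (x ord0 i); rewrite intrD; lra.
by rewrite opprB addrA subrK.
Unshelve. all: by end_near. Qed.
End Differential.

(** * Lifting a torus map that rescales a linear flow *)

Section RescaledFlow.
Context {R : realType} {n : nat}.
Implicit Types (f g : torus R n -> torus R n) (x y v w a : 'rV[R]_n) (p : torus R n).

(** A smooth torus map lifts to R^n (up to a translation), and the lift differs
    from a linear map with integer matrix [B] by a Z^n-periodic map: the
    increment of [r] under an integer translation [k] is uniformly locally
    constant, hence constant, integral and additive in [k].  [B] is the action
    on the fundamental group. *)
Lemma torus_map_lift f : smooth_torus_map f ->
  exists (e : R) (r : 'rV[R]_n -> 'rV[R]_n) (B : 'M[int]_n),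
  [/\ 0 < e, r 0 = 0,
      forall x y, `|x - y| < e -> displacement f x y = r y - r x,
      forall x (k : 'rV[int]_n), r (x + int_mx k) = r x + int_mx (k *m B) &
      exists M, forall x, `|x| <= 1 -> `|r x| <= M].
Proof.
move=> fS; have [e e0 small] := displacement_uniform fS.
have cocycle x y z : `|x - y| < e -> `|y - z| < e ->
    displacement f x y + displacement f y z = displacement f x z.
  move=> /small xy /small yz; apply: torus_proj_inj.
    by rewrite torus_projD !chart_proj_sub addrC subrKA.
  have := chart_norm_le (f (torus_proj x)) (f (torus_proj z)).
  have := ler_normB (displacement f x y + displacement f y z) (displacement f x z).
  have := ler_normD (displacement f x y) (displacement f y z).
  rewrite -/(displacement f x z); lra.
pose r := primitive (displacement f) e.
have rB x y : `|x - y| < e -> displacement f x y = r y - r x.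
  exact: primitiveB.
have r0 : r 0 = 0 by exact: primitive0.
have rP x : torus_proj (r x) = f (torus_proj x) - f (torus_proj 0).
  rewrite /r /primitive /ray_sum; set N := (Num.trunc _).+1.
  rewrite (big_morph _ torus_projD torus_proj0).
  rewrite (telescope_sumr_eq (fun k => f (torus_proj ((k%:R / N%:R) *: x))))//;
    last by move=> k _; rewrite chart_proj_sub.
  by rewrite mul0r scale0r divff ?scale1r// pnatr_eq0.
have periodic k x : torus_proj (x + int_mx k) = torus_proj x :> torus R n.
  apply/torus_projP => i; rewrite !mxE addrAC subrr add0r; exact: rpred_int.
have r_shift k x : r (x + int_mx k) = r x + r (int_mx k).
  pose g y := r (y + int_mx k) - r y.
  have : g x = g 0.
    apply: (uniformly_locally_constant e0) => y z yz.
    have : r (z + int_mx k) - r (y + int_mx k) = r z - r y.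
      rewrite -!rB//; first by rewrite /displacement !periodic.
      by rewrite opprD addrACA subrr addr0.
    move=> /rowP E; apply/rowP => i; have := E i; rewrite !mxE; lra.
  by rewrite /g add0r r0 subr0 => /eqP; rewrite subr_eq => /eqP ->; exact: addrC.
pose psi (k : 'rV[int]_n) := r (int_mx k).
have psiB : zmod_morphism psi.
  move=> k l; apply/eqP; rewrite eq_sym subr_eq; apply/eqP.
  by rewrite /psi -r_shift /int_mx -map_mxD subrK.
pose Psi : {additive 'rV[int]_n -> 'rV[R]_n} :=
  HB.pack psi (GRing.isZmodMorphism.Build _ _ _ psiB).
have psi_int k i : psi k 0 i \is a Num.int.
  have /torus_projP/(_ i) : torus_proj (psi k) = torus_proj 0.
    by rewrite torus_proj0 rP -(periodic k 0) add0r subrr.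
  by rewrite mxE subr0.
pose B : 'M[int]_n := \matrix_(i, j) Num.floor (psi (delta_mx 0 i) 0 j).
exists e, r, B; split => // [x k|]; last first.
  by apply: (primitive_bounded _ _ (c := 2^-1)) => // x y; exact: chart_norm_le.
rewrite r_shift; congr (_ + _).
rewrite [in LHS](row_sum_delta k) -[LHS]/(Psi _) raddf_sum.
apply/rowP => j; rewrite summxE !mxE rmorph_sum; apply: eq_bigr => i _ /=.
have -> : k 0 i *: (delta_mx 0 i : 'rV[int]_n) = delta_mx 0 i *~ k 0 i.
  by rewrite -scaler_int intz.
have -> : psi (delta_mx 0 i *~ k 0 i) = psi (delta_mx 0 i) *~ k 0 i := raddfMz Psi _ _.
by rewrite -scaler_int !mxE intrM floorK.
Qed.

(** The lift sends orbits of the flow to orbits, rescaling time by [alpha]: the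
    two sides have the same derivative in [t]. *)
Lemma lift_along_flow f alpha a e (r : 'rV[R]_n -> 'rV[R]_n) (t : R) :
  smooth_torus_map f ->
  (forall p, tangent_map f p a = alpha *: a) ->
  0 < e -> r 0 = 0 ->
  (forall x y, `|x - y| < e -> displacement f x y = r y - r x) ->
  r (t *: a) = t *: (alpha *: a).
Proof.
move=> fS fa e0 r0 rB.
pose H s := r (s *: a) - s *: (alpha *: a).
suff HC i : H t 0 i = H 0 0 i.
  apply/eqP; rewrite -subr_eq0; apply/eqP/rowP => i; rewrite -/(H t) HC.
  by rewrite /H !scale0r r0 subr0.
have dr s : is_derive s (1 : R) (fun s : R => r (s *: a)) (alpha *: a).
  pose G w := chart (f (torus_proj (s *: a))) (f (torus_proj (s *: a) + torus_proj w)).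
  have dG : differentiable G 0 by exact: local_map_differentiable.
  have GE : 'D_a G 0 = alpha *: a by rewrite deriveE// -(fa (torus_proj (s *: a))).
  have aG : h^-1 *: (G (h *: a + 0) - G 0) @[h --> 0^'] --> alpha *: a.
    by rewrite -GE; apply: diff_derivable.
  have ar : h^-1 *: (r ((h *: 1 + s) *: a) - r (s *: a)) @[h --> (0:R)^'] --> alpha *: a.
    apply: cvg_trans aG; apply: near_eq_cvg.
    have : (h *: a) @[h --> (0 : R)^'] --> (0 : R) *: a.
      by apply: cvgZr_tmp; apply: cvg_within_filter; exact: cvg_id.
    rewrite scale0r => /cvgr_norm_lt/(_ e); rewrite normr0 => /(_ e0).
    apply: filterS => h he; congr (_ *: _).
    have -> : (h *: 1 + s) *: a = s *: a + h *: a.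
      by rewrite scalerDl addrC /GRing.scale /= mulr1.
    rewrite -rB; last by rewrite opprD addrA subrr add0r normrN.
    rewrite /displacement torus_projD addr0 /G torus_proj0 addr0 chart_refl.
    by rewrite subr0.
  by apply: DeriveDef; [apply/cvg_ex; eexists; exact: ar | exact: cvg_lim ar].
have dH s : is_derive s (1 : R) H 0.
  apply: is_derive_eq (is_deriveB (dr s) (is_derive_scalel (alpha *: a) s)) _.
  exact: subrr.
apply: (@is_derive_0_is_cst _ (fun s => H s 0 i)) => s.
have Hd : derivable H s 1 by case: (dH s).
apply: DeriveDef; first by have /derivable_mxP := Hd; apply.
by have := derive_mx Hd; rewrite derive_val => /matrixP/(_ 0 i); rewrite !mxE => <-.
Qed.

(** The lift is within bounded distance of [x |-> x B], and along the orbit it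
    is [t alpha a]; so [t (alpha a - a B)] stays bounded for all [t]. *)
Lemma multiplier_integral_matrix f alpha a : smooth_torus_map f ->
  (forall p, tangent_map f p a = alpha *: a) ->
  exists B : 'M[int]_n, a *m int_mx B = alpha *: a.
Proof.
move=> fS fa; have [e [r [B [e0 r0 rB rk [M rM]]]]] := torus_map_lift fS.
exists B; apply/eqP; rewrite eq_sym -subr_eq0 -normr_le0; apply/ler_addgt0Pl => d d0.
set w := alpha *: a - _.
pose C := M + \sum_k \sum_j `|(int_mx B : 'M[R]_n) k j|.
have bound (t : R) : `|t *: w| <= C.
  (* r minus the linear map of matrix B is Z^n-periodic, so its value at t a is
     its value at the reduction y of t a modulo Z^n, which is bounded *)
  pose k : 'rV[int]_n := \row_i Num.floor ((t *: a) 0 i).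
  pose y := t *: a - int_mx k.
  have y1 : `|y| <= 1.
    apply: mx_norm_le => // i j; rewrite ord1 !mxE ler_norml.
    by have := floor_itv (t * a 0 j); rewrite intrD; lra.
  have -> : t *: w = r y - y *m int_mx B.
    rewrite /w scalerBr -(lift_along_flow t fS fa e0 r0 rB).
    rewrite -{1}(subrK (int_mx k) (t *: a)) -/y rk.
    have -> : y *m int_mx B = t *: (a *m int_mx B) - int_mx (k *m B).
      by rewrite mulmxBl -scalemxAl /int_mx map_mxM.
    by rewrite opprB addrA.
  rewrite (le_trans (ler_normB _ _))// lerD ?rM// (le_trans (mulmx_norm_le _ _))//.
  by rewrite ler_piMr// sumr_ge0// => i _; rewrite sumr_ge0.
have C1 : 0 < `|C| + 1 by rewrite ltr_wpDl.
(* the added 1 covers the case C = 0 *)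
have := bound ((`|C| + 1) / d); rewrite normrZ gtr0_norm ?divr_gt0//.
rewrite mulrAC ler_pdivrMr// addr0 => wd; rewrite -(ler_pM2l C1).
by rewrite (le_trans wd)// ler_pM2r// (le_trans (ler_norm C))// lerDl.
Qed.
End RescaledFlow.

(** * Algebraic integers in a real number field *)

Lemma horner_mx_eigenvector (K : comNzRingType) (n : nat) (A : 'M[K]_n.+1)
    (b : 'cV_n.+1) (x : K) (p : {poly K}) :
  A *m b = x *: b -> horner_mx A p *m b = p.[x] *: b.
Proof.
move=> Ab; elim/poly_ind: p => [|p c IH].
  by rewrite rmorph0 horner0 mul0mx scale0r.
rewrite rmorphD rmorphM /= horner_mx_X horner_mx_C !hornerE mulmxDl.
rewrite -[_ * A]/(_ *m A) -mulmxA Ab -scalemxAr IH mul_scalar_mx.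
by rewrite scalerDl scalerA mulrC.
Qed.

(** An eigenvalue of an integer matrix is a root of its characteristic
    polynomial, which is monic with integer coefficients.  It
    applies to multipliers and to multiples of arbitrary elements of [F]. *)
Lemma integral_eigenvalue (K : fieldType) (n : nat) (B : 'M[int]_n)
    (b : 'cV[K]_n) (x : K) :
  b != 0 -> map_mx intr B *m b = x *: b -> integralOver (intr : int -> K) x.
Proof.
move=> bN0 Bb; exists (char_poly B); first exact: char_poly_monic.
have char_tr : char_poly (map_mx intr B)^T = char_poly (map_mx intr B : 'M[K]_n).
  rewrite /char_poly -[RHS]det_tr; congr (\det _).
  by apply/matrixP => i j; rewrite !mxE eq_sym.
rewrite map_char_poly -char_tr -eigenvalue_root_char.
apply/eigenvalueP; exists b^T; last by rewrite -trmx0 (inj_eq trmx_inj).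
by rewrite -trmx_mul Bb linearZ.
Qed.

(** Over the algebraic closure the trace is the sum of the eigenvalues, each of
    which is a root of [p] and so an algebraic integer; a rational algebraic
    integer is an integer. *)
Lemma mxtrace_int (n : nat) (M : 'M[rat]_n.+1) (p : {poly int}) :
  p \is monic -> horner_mx M (map_poly intr p) = 0 ->
  \tr M \is a Num.int.
Proof.
move=> pmon pM0; rewrite -Cint_rat.
apply: Cint_rat_Aint (Crat_rat _) _.
set MC : 'M[algC]_n.+1 := map_mx ratr M.
have [r Er] := closed_field_poly_normal (char_poly MC).
move: Er; rewrite (monicP (char_poly_monic _)) scale1r => Er.
have sr : size r = n.+1.
  by apply/eqP; rewrite -eqSS -(size_char_poly MC) Er size_prod_XsubC.
have := coefPn_prod_XsubC (ps := r); rewrite sr -Er => /(_ isT).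
rewrite char_poly_trace// => /oppr_inj.
have trE : \tr MC = ratr (\tr M).
  by rewrite /mxtrace rmorph_sum; apply: eq_bigr => i _; rewrite mxE.
rewrite trE => ->; rewrite big_seq rpred_sum// => z zr.
have MCz : eigenvalue MC z by rewrite eigenvalue_root_char Er root_prod_XsubC.
have pMC0 : horner_mx MC (map_poly intr p) = 0.
  have -> : map_poly intr p = map_poly (ratr : rat -> algC) (map_poly intr p).
    by rewrite -map_poly_comp; apply: eq_map_poly => i /=; rewrite ratr_int.
  by rewrite -map_horner_mx pM0 map_mx0.
apply: (@root_monic_Aint (map_poly intr p)).
- move: MCz; rewrite eigenvalue_root_min !root_factor_theorem.
  by move=> zM; apply: dvdp_trans zM (mxminpoly_min pMC0).
- exact: monic_map.
- by apply/polyOverP => i; rewrite coef_map /= rpred_int.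
Qed.

Section NumberField.
Variables (R : realType) (n : nat) (F : {pred R}).
Implicit Types (a b : 'cV[R]_n) (x : R).

(** Bases are columns, so that multiplication by [x] reads [M *m b = x *: b] and
    a change of basis is a matrix product. *)
Definition isbasis b := Qbasis F (fun i => b i 0).

Lemma basis_free b (m : nat) (C : 'M[rat]_(m, n)) :
  isbasis b -> map_mx ratr C *m b = 0 -> C = 0.
Proof.
move=> [_ free_b _] /matrixP Cb; apply/matrixP => i j; rewrite mxE.
apply: (free_b (fun j => C i j)) => //.
by have := Cb i 0; rewrite !mxE => Cbi; rewrite -[RHS]Cbi; apply: eq_bigr => k _; rewrite mxE.
Qed.

Lemma basis_inj b (m : nat) (C D : 'M[rat]_(m, n)) :
  isbasis b -> map_mx ratr C *m b = map_mx ratr D *m b -> C = D.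
Proof.
move=> bb CD; apply/eqP; rewrite -subr_eq0; apply/eqP/(basis_free bb).
by rewrite map_mxB mulmxBl CD subrr.
Qed.

Lemma basis_span b (m : nat) (v : 'cV[R]_m) :
  isbasis b -> (forall i, v i 0 \in F) ->
  exists C : 'M[rat]_(m, n), v = map_mx ratr C *m b.
Proof.
move=> [_ _ span_b] vF.
pose c i := projT1 (cid (span_b _ (vF i))).
exists (\matrix_(i, j) c i j); apply/matrixP => i k; rewrite ord1 mxE.
rewrite (projT2 (cid (span_b _ (vF i)))); apply: eq_bigr => j _.
by rewrite !mxE.
Qed.

Hypothesis Fring : divring_closed F.

#[local] HB.instance Definition _ := GRing.isDivringClosed.Build R F Fring.

Lemma ratr_field c : ratr c \in F.
Proof. by rewrite /ratr rpred_div// rpred_int. Qed.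

Lemma rational_comb_field b (m : nat) (C : 'M[rat]_(m, n)) i :
  isbasis b -> (map_mx ratr C *m b) i 0 \in F.
Proof.
move=> [bF _ _]; rewrite mxE rpred_sum// => j _.
by rewrite mxE rpredM// ratr_field.
Qed.

Lemma basis_change b (C : 'M[rat]_n) :
  isbasis b -> C \in unitmx -> isbasis (map_mx ratr C *m b).
Proof.
move=> bb Cu; split=> [i|c c0 i|x xF].
- exact: rational_comb_field.
- suff /matrixP/(_ 0 i) : (\row_j c j) = 0 by rewrite !mxE.
  rewrite -[LHS](mulmxK Cu); suff -> : (\row_j c j) *m C = 0 by rewrite mul0mx.
  apply: (basis_free bb); rewrite map_mxM -mulmxA.
  apply/matrixP => k l; rewrite !ord1 mxE [RHS]mxE -[RHS]c0.
  by apply: eq_bigr => j _; rewrite !mxE.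
- have [|D xD] := @basis_span b 1 (const_mx x) bb; first by move=> i; rewrite ord1 mxE.
  exists (fun j => (D *m invmx C) 0 j).
  have /matrixP/(_ 0 0) := xD; rewrite mxE => ->.
  rewrite -[X in map_mx _ X](mulmxKV Cu) map_mxM -mulmxA mxE.
  by apply: eq_bigr => j _; rewrite [in LHS]mxE.
Qed.

Lemma multiplication_matrix b x : isbasis b -> x \in F ->
  exists M : 'M[rat]_n, map_mx ratr M *m b = x *: b.
Proof.
move=> bb xF; have [|M ->] := @basis_span b n (x *: b) bb; last by exists M.
by move=> i; rewrite mxE rpredM//; case: bb => + _ _; apply.
Qed.

Definition multmx b x : 'M[rat]_n :=
  xget 0 [set M | map_mx ratr M *m b = x *: b].

Lemma multmxE b x : isbasis b -> x \in F -> map_mx ratr (multmx b x) *m b = x *: b.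
Proof.
move=> bb xF; have [M Mb] := multiplication_matrix bb xF.
exact: (@xgetPex _ 0 [set M | map_mx ratr M *m b = x *: b]) (ex_intro _ M Mb).
Qed.

Lemma multmx_eq b x M : isbasis b -> x \in F ->
  map_mx ratr M *m b = x *: b -> multmx b x = M.
Proof. by move=> bb xF Mb; apply: (basis_inj bb); rewrite multmxE. Qed.

Definition fieldtr b x : rat := \tr (multmx b x).

Lemma fieldtr_sum b (m : nat) (c : 'I_m -> rat) (x : 'I_m -> R) :
  isbasis b -> (forall i, x i \in F) ->
  fieldtr b (\sum_i ratr (c i) * x i) = \sum_i c i * fieldtr b (x i).
Proof.
move=> bb xF; rewrite /fieldtr (@multmx_eq _ _ (\sum_i c i *: multmx b (x i)))//.
- by rewrite raddf_sum; apply: eq_bigr => i _; rewrite /= mxtraceZ.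
- by rewrite rpred_sum// => i _; rewrite rpredM// ratr_field.
- rewrite raddf_sum mulmx_suml scaler_suml; apply: eq_bigr => i _.
  by rewrite /= map_mxZ -scalemxAl multmxE// scalerA.
Qed.

Lemma fieldtr1 b : isbasis b -> fieldtr b 1 = n%:R.
Proof.
move=> bb; rewrite /fieldtr (@multmx_eq _ _ 1%:M) ?mxtrace1// ?rpred1//.
by rewrite map_mx1 mul1mx scale1r.
Qed.

(** The trace form of the field evaluated on [b].  The trace is always computed
    in the fixed basis [a]; this way [gram_change] is a formal consequence of
    bilinearity and the independence of the trace from the basis never
    arises. *)
Definition gram a b : 'M[rat]_n := \matrix_(i, j) fieldtr a (b i 0 * b j 0).

Lemma gramE a b (m p : nat) (C : 'M[rat]_(m, n)) (D : 'M[rat]_(p, n)) i j :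
  isbasis a -> isbasis b ->
  fieldtr a ((map_mx ratr C *m b) i 0 * (map_mx ratr D *m b) j 0) =
  (C *m gram a b *m D^T) i j.
Proof.
move=> aa bb; have bF : forall k, b k 0 \in F by case: bb.
rewrite [in LHS]mxE mulr_suml.
under eq_bigr do rewrite mxE -mulrA.
rewrite fieldtr_sum//; last by move=> k; rewrite rpredM// rational_comb_field.
rewrite -mulmxA [RHS]mxE; apply: eq_bigr => k _; congr (_ * _).
rewrite [in LHS]mxE mulr_sumr [RHS]mxE.
under eq_bigr do rewrite mxE mulrCA.
rewrite fieldtr_sum//; last by move=> l; rewrite rpredM.
by apply: eq_bigr => l _; rewrite !mxE mulrC.
Qed.

Lemma gram_change a b (C : 'M[rat]_n) : isbasis a -> isbasis b ->
  gram a (map_mx ratr C *m b) = C *m gram a b *m C^T.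
Proof. by move=> aa bb; apply/matrixP => i j; rewrite mxE gramE. Qed.

(** The trace form is nondegenerate in characteristic 0: a nonzero [x] in its
    radical would give [Tr (x * x^-1) = 0], while [Tr 1 = n]. *)
Lemma det_gram_neq0 a b : (0 < n)%N -> isbasis a -> isbasis b ->
  \det (gram a b) != 0.
Proof.
move=> n_gt0 aa bb; apply/det0P => -[v vN0 v0].
pose x := (map_mx ratr v *m b) 0 0.
have xF : x \in F by exact: rational_comb_field.
have xN0 : x != 0.
  apply: contraNneq vN0 => x0; apply/eqP/(basis_free bb).
  by apply/matrixP => i j; rewrite !ord1 [RHS]mxE.
have [|d /matrixP/(_ 0 0)] := @basis_span b 1 (const_mx x^-1) bb.
  by move=> i; rewrite mxE rpredV.
rewrite mxE => xV; have := @gramE a b 1 1 v d 0 0 aa bb.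
rewrite -xV divff// fieldtr1// v0 mul0mx mxE => /eqP.
by rewrite pnatr_eq0 eqn0Ngt n_gt0.
Qed.

Lemma divring_closedM x y : x \in F -> y \in F -> x * y \in F.
Proof. exact: rpredM. Qed.

End NumberField.

Lemma fieldtr_integral (R : realType) (n : nat) (F : {pred R}) (b : 'cV[R]_n) x :
  divring_closed F -> isbasis F b -> x \in F ->
  integralOver (intr : int -> R) x -> fieldtr b x \is a Num.int.
Proof.
move=> Fring; case: n b => [|n] b bb xF [p pmon px0].
  by rewrite /fieldtr /mxtrace big_ord0 rpred0.
apply: (mxtrace_int pmon).
apply: (basis_free bb); rewrite map_horner_mx.
rewrite (horner_mx_eigenvector _ (multmxE Fring bb xF)).
rewrite -map_poly_comp (@eq_map_poly _ _ _ intr); last first.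
  by move=> i /=; rewrite ratr_int.
by rewrite (rootP px0) scale0r.
Qed.

(** If [M] is the matrix of multiplication by [b i], then [d M] is an integer
    matrix for a common denominator [d] of its entries; so [d * b i], an
    eigenvalue of it, is an algebraic integer. *)
Lemma integral_basis_exists (R : realType) (n : nat) (F : {pred R}) (b : 'cV[R]_n) :
  divring_closed F -> isbasis F b ->
  exists a : 'cV[R]_n, isbasis F a /\ forall i, integralOver (intr : int -> R) (a i 0).
Proof.
move=> Fring bb; have bF i : b i 0 \in F by case: bb.
have intmul i : exists2 d : int, d != 0 &
    integralOver (intr : int -> R) (d%:~R * b i 0).
  have bN0 : b != 0.
    apply/negP => /eqP b0; have [_ free_b _] := bb.
    have := free_b (fun=> 1); rewrite big1 => [/(_ erefl i)/eqP//|j _].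
    by rewrite b0 mxE mulr0.
  have [M Mb] := multiplication_matrix Fring bb (bF i).
  pose d : int := \prod_(p : 'I_n * 'I_n) denq (M p.1 p.2).
  exists d; first by apply/prodf_neq0 => p _; rewrite denq_neq0.
  have dM k l : exists z : int, d%:~R * M k l = z%:~R.
    rewrite /d (bigD1 (k, l))//= intrM mulrAC [_ * M k l]mulrC -numqE -intrM.
    by eexists.
  pose B := \matrix_(k, l) projT1 (cid (dM k l)).
  apply: (@integral_eigenvalue _ _ B b) => //.
  rewrite -scalerA -Mb scalemxAl; congr (_ *m _); apply/matrixP => k l.
  rewrite !mxE; case: cid => z /= dMz.
  by rewrite -[LHS](ratr_int R) -dMz rmorphM /= ratr_int.
pose d i := projT1 (cid2 (intmul i)).
have dN0 i : d i != 0 by rewrite /d; case: cid2.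
pose D : 'M[rat]_n := diag_mx (\row_i (d i)%:~R).
exists (map_mx ratr D *m b); split.
  apply: basis_change => //; rewrite unitmxE det_diag unitfE.
  by apply/prodf_neq0 => i _; rewrite mxE intr_eq0 dN0.
move=> i; rewrite map_diag_mx mul_diag_mx !mxE /= ratr_int.
by rewrite /d; case: cid2.
Qed.

(** The cofactors along row [k] do not see row [k], hence are those of the
    identity matrix. *)
Lemma det_replace_row (K : comNzRingType) (n : nat) (k : 'I_n) (c : 'I_n -> K) :
  \det (\matrix_(i, j) if i == k then c j else (i == j)%:R) = c k.
Proof.
set C := \matrix_(i, j) _.
have cofC j : cofactor C k j = (j == k)%:R.
  have /matrixP/(_ j k) := adj1 K n; rewrite !mxE => <-.
  rewrite /cofactor; congr (_ * \det _); apply/matrixP => i l.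
  by rewrite !mxE [lift k i == k]eq_sym (negPf (neq_lift k i)).
rewrite (expand_det_row _ k) (bigD1 k)//= cofC eqxx mulr1 mxE eqxx.
by rewrite big1 ?addr0// => j /negPf jk; rewrite cofC jk mulr0.
Qed.

(** Among the bases of [F] made of algebraic integers, take one whose
    discriminant [\det (gram a b)], a nonzero integer, has least absolute
    value.  If an algebraic integer had a coordinate [C 0 k] outside Z on it,
    then replacing [b k] by [x - floor (C 0 k) b k] would multiply the
    discriminant by the square of the fractional part of [C 0 k]. *)
Lemma integral_basis (R : realType) (n : nat) (F : {pred R}) :
  (0 < n)%N -> real_number_field n F ->
  exists b : 'cV[R]_n, [/\ isbasis F b,
    forall i, integralOver (intr : int -> R) (b i 0) &
    forall x, x \in F -> integralOver (intr : int -> R) x ->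
      exists c : 'rV[int]_n, x = (map_mx intr c *m b) 0 0].
Proof.
move=> n_gt0 [Fring [b0 b0b]].
have bb0 : isbasis F (\col_i b0 i).
  rewrite /isbasis (_ : (fun i => _) = b0)//.
  by apply/funext => i; rewrite mxE.
have [a [aa a_int]] := integral_basis_exists Fring bb0.
pose good (m : nat) (b : 'cV[R]_n) := [/\ isbasis F b,
  forall i, integralOver (intr : int -> R) (b i 0) &
  `|\det (gram a b)| = m%:R].
have goodE b : isbasis F b -> (forall i, integralOver (intr : int -> R) (b i 0)) ->
    exists m, good m b.
  move=> bb b_int; suff /natrP[m dm] : `|\det (gram a b)| \is a Num.nat by exists m.
  apply: natr_norm_int; rewrite rpred_sum// => s _.
  rewrite rpredM ?rpredX ?rpredN1// rpred_prod// => i _; rewrite mxE.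
  apply: (fieldtr_integral Fring aa); last exact: integral_mul.
  by have [bF _ _] := bb; rewrite (divring_closedM Fring).
have exgood : exists m, `[< exists b, good m b >].
  by have [m ?] := goodE _ aa a_int; exists m; apply/asboolP; exists a.
case: (ex_minnP exgood) => m /asboolP[b [bb b_int bm]] min_m.
exists b; split=> // x xF x_int.
have [|C /matrixP/(_ 0 0)] := @basis_span _ _ _ b 1 (const_mx x) bb.
  by move=> i; rewrite mxE.
rewrite mxE => xE.
suff Cint : forall k, C 0 k \is a Num.int.
  exists (map_mx Num.floor C); rewrite xE; congr ((_ *m _) 0 0).
  apply/matrixP => i j; rewrite !ord1 !mxE.
  by rewrite -[in LHS](floorK (Cint j)) ratr_int.
move=> k; apply: contraT => CkN.
pose f := Num.floor (C 0 k); pose r := C 0 k - f%:~R.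
have r_gt0 : 0 < r.
  rewrite subr_gt0 lt_neqAle floor_le andbT.
  by apply: contraNneq CkN => <-; rewrite rpred_int.
have r_lt1 : r < 1.
  by rewrite ltrBlDl; have := floorD1_gt (C 0 k); rewrite intrD.
pose D : 'M[rat]_n := \matrix_(i, j)
  if i == k then C 0 j - f%:~R * (j == k)%:R else (i == j)%:R.
have detD : \det D = r by rewrite det_replace_row eqxx mulr1.
have Du : D \in unitmx by rewrite unitmxE detD unitfE gt_eqF.
have bb' := basis_change Fring bb Du.
have b'_int i : integralOver (intr : int -> R) ((map_mx ratr D *m b) i 0).
  have [->|ik] := eqVneq i k.
    rewrite (_ : (map_mx ratr D *m b) k 0 = x - f%:~R * b k 0).
      by apply: integral_sub => //; apply: integral_mul => //; exact: integral_id.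
    rewrite xE [LHS]mxE [in RHS]mxE.
    transitivity (\sum_j (ratr (C 0 j) * b j 0 - (f%:~R * (j == k)%:R) * b j 0)).
      apply: eq_bigr => j _; rewrite !mxE eqxx rmorphB rmorphM /=.
      by rewrite ratr_int rmorph_nat mulrBl.
    rewrite big_split/= sumrN; congr (_ - _).
      by apply: eq_bigr => j _; rewrite mxE.
    rewrite (bigD1 k)//= eqxx mulr1 big1 ?addr0// => j /negPf ->.
    by rewrite mulr0 mul0r.
  rewrite (_ : (map_mx ratr D *m b) i 0 = b i 0)// mxE (bigD1 i)//= big1 ?addr0.
    by rewrite !mxE (negPf ik) eqxx rmorph1 mul1r.
  by move=> j ji; rewrite !mxE (negPf ik) eq_sym (negPf ji) rmorph0 mul0r.
have [m' gm'] := goodE _ bb' b'_int.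
have : (m <= m')%N by apply: min_m; apply/asboolP; eexists; exact: gm'.
case: gm' => _ _ m'E; rewrite -(ler_nat rat) -m'E -bm.
have G_gt0 : 0 < `|\det (gram a b)|.
  by rewrite normr_gt0 (det_gram_neq0 Fring).
rewrite (gram_change Fring)// !det_mulmx det_tr detD mulrAC !normrM.
by rewrite (gtr0_norm r_gt0) ler_pMl// leNgt mulr_ilt1 ?ltW.
Qed.

(** * Multipliers of a linear flow *)

Lemma map_ratr_int (R : realType) (m n : nat) (B : 'M[int]_(m, n)) :
  map_mx ratr (map_mx intr B) = map_mx intr B :> 'M[R]_(m, n).
Proof. by apply/matrixP => i j; rewrite !mxE ratr_int. Qed.

Lemma flow_multiplierP (R : realType) (n : nat) (a : 'rV[R]_n)
    (f : torus_diffeo R n) alpha :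
  is_multiplier (linear_flow a) f alpha <->
  alpha != 0 /\ forall p, tangent_map f p a = alpha *: a.
Proof.
split=> -[alpha0 fa]; split=> // p.
  have := fa (f p); rewrite /push_forward !generator_linear_flow.
  by rewrite (diffeo_funK f).
by rewrite /push_forward !generator_linear_flow fa.
Qed.

Lemma multiplier_groupE (R : realType) (n : nat) (a : 'rV[R]_n) : a != 0 ->
  multiplier_group (linear_flow a) =
  [set alpha | exists f, is_multiplier (linear_flow a) f alpha].
Proof.
move=> a0.
have uniq f alpha beta : is_multiplier (linear_flow a) f alpha ->
    is_multiplier (linear_flow a) f beta -> alpha = beta.
  move=> /flow_multiplierP[_ /(_ 0)] + /flow_multiplierP[_ /(_ 0)] => -> /eqP.
  by rewrite -subr_eq0 -scalerBl scaler_eq0 (negPf a0) orbF subr_eq0 => /eqP.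
have rhoE f alpha : is_multiplier (linear_flow a) f alpha ->
    rho (linear_flow a) f = alpha.
  move=> fa; apply: (uniq f _ _ _ fa).
  exact: (@xgetPex _ 0 [set alpha | is_multiplier (linear_flow a) f alpha]) (ex_intro _ _ fa).
apply/seteqP; split=> [_ [f [alpha fa] <-]|alpha [f fa]].
  by exists f; rewrite (rhoE _ _ fa).
by exists f; [exists alpha | exact: rhoE].
Qed.

(** The multiplier of [f] is an eigenvalue of an integer matrix, and so is that
    of the inverse of [f], which is its inverse.  Both multipliers lie in [F] because
    the coordinates of the eigenvector do. *)
Lemma flow_multiplier_integral (R : realType) (n : nat) (F : {pred R})
    (b : 'cV[R]_n) (f : torus_diffeo R n) alpha :
  divring_closed F -> b != 0 -> isbasis F b ->
  is_multiplier (linear_flow b^T) f alpha ->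
  unit_group (ring_of_integers F) alpha.
Proof.
move=> Fring b0 bb /flow_multiplierP[alpha0 fa].
have eigen beta (B : 'M[int]_n) : b^T *m int_mx B = beta *: b^T ->
    ring_of_integers F beta.
  move=> bB; have Bb : map_mx intr B^T *m b = beta *: b.
    by apply: trmx_inj; rewrite trmx_mul -map_trmx trmxK bB linearZ.
  split; last exact: integral_eigenvalue Bb.
  have [_ _ Fdiv] := Fring.
  have /matrix0Pn[i [j]] := b0; rewrite ord1 => bi.
  have /matrixP/(_ i 0) := Bb; rewrite [RHS]mxE -map_ratr_int.
  move=> betaE; rewrite -[beta](mulfK bi) -betaE; apply: Fdiv; last by case: bb.
  exact: rational_comb_field.
have [B bB] := multiplier_integral_matrix (diffeo_smooth f) fa.
have ga p : tangent_map (diffeo_inv f) p b^T = alpha^-1 *: b^T.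
  have df : tangent_map f (diffeo_inv f p) (alpha^-1 *: b^T) = b^T.
    have := fa (diffeo_inv f p); rewrite /tangent_map linearZ /= => ->.
    by rewrite scalerA mulVf// scale1r.
  rewrite -[in LHS]df -{1}(diffeo_invK f p).
  by rewrite (tangent_map_inverse _ _ (diffeo_funK f) (diffeo_smooth f)
    (diffeo_inv_smooth f)).
have [C bC] := multiplier_integral_matrix (diffeo_inv_smooth f) ga.
split; first exact: eigen bB.
by exists alpha^-1; [exact: eigen bC | rewrite divff].
Qed.

(** A unit maps the ring of integers, the lattice spanned by [b], onto itself.
    Its matrix on [b] is therefore invertible over Z and induces an
    automorphism of the torus. *)
Lemma unit_multiplier (R : realType) (n : nat) (F : {pred R})
    (b : 'cV[R]_n) u :
  divring_closed F -> isbasis F b ->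
  (forall i, integralOver (intr : int -> R) (b i 0)) ->
  (forall x, x \in F -> integralOver (intr : int -> R) x ->
      exists c : 'rV[int]_n, x = (map_mx intr c *m b) 0 0) ->
  unit_group (ring_of_integers F) u ->
  exists f : torus_diffeo R n, is_multiplier (linear_flow b^T) f u.
Proof.
move=> Fring bb b_int b_span [uO [v vO uv]].
have bF i : b i 0 \in F by case: bb.
have int_action x : ring_of_integers F x ->
    exists B : 'M[int]_n, b^T *m int_mx B = x *: b^T.
  move=> [xF x_int].
  have row_c i : exists c : 'rV[int]_n, x * b i 0 = (map_mx intr c *m b) 0 0.
    by apply: b_span; [exact: divring_closedM|exact: integral_mul].
  exists (\matrix_(i, j) projT1 (cid (row_c j)) 0 i).
  apply/rowP => j; rewrite [RHS]mxE [in RHS]mxE (projT2 (cid (row_c j))).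
  by rewrite !mxE; apply: eq_bigr => k _; rewrite !mxE mulrC.
have [B bB] := int_action _ uO; have [C bC] := int_action _ vO.
have inv (D E : 'M[int]_n) (x y : R) : x * y = 1 ->
    b^T *m int_mx D = x *: b^T -> b^T *m int_mx E = y *: b^T -> D *m E = 1%:M.
  move=> xy bD bE.
  have DEb : map_mx ratr (map_mx intr (D *m E)^T) *m b = map_mx ratr 1%:M *m b.
    rewrite map_ratr_int map_mx1 mul1mx; apply: trmx_inj.
    rewrite trmx_mul -map_trmx trmxK map_mxM mulmxA -/(int_mx D) bD.
    by rewrite -scalemxAl -/(int_mx E) bE scalerA xy scale1r.
  have /matrixP DE1 := basis_inj bb DEb.
  apply/matrixP => i j; have := DE1 j i; rewrite [LHS]mxE [in LHS]mxE => DEij.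
  by apply: (@intr_inj rat); rewrite DEij !mxE eq_sym rmorph_nat.
have u0 : u != 0.
  by apply/eqP => u0; move/eqP: uv; rewrite u0 mul0r eq_sym oner_eq0.
exists (torus_automorphism (inv _ _ _ _ uv bB bC)
  (inv _ _ _ _ (etrans (mulrC _ _) uv) bC bB)).
apply/flow_multiplierP; split => // p; rewrite -bB.
by apply: tangent_map_linear => w; rewrite /= torus_linear_shift.
Qed.

Theorem theorem3p8 (R : realType) (n : nat) (hn : (2 <= n)%N) (F : {pred R})
  (hF : real_number_field n F) :
  exists phi : R -> torus R n -> torus R n,
    [/\ is_flow phi, quasiperiodic phi, F_algebraic F phi &
        multiplier_group phi = unit_group (ring_of_integers F)].
Proof.
have [Fring _] := hF.
have [b [bb b_int b_span]] := integral_basis (ltnW hn) hF.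
have [bF free_b _] := bb.
have b0 : b != 0.
  apply: contraTneq isT => b0; have := free_b (fun=> 1).
  rewrite big1 => [/(_ erefl (Ordinal hn))/eqP//|j _].
  by rewrite b0 mxE mulr0.
pose phi := linear_flow b^T.
have gen p : generator phi p = b^T by exact: generator_linear_flow.
have bE : b^T 0 = (fun i => b i 0) by apply/funext => i; rewrite mxE.
have QP : quasiperiodic phi.
  exists (torus_automorphism (mulmx1 1%:M) (mulmx1 1%:M)), b^T.
  rewrite bE; split=> // p; rewrite (_ : generator phi = fun=> b^T); last exact/funext.
  by rewrite push_forward_automorphism /int_mx map_mx1 mulmx1.
exists phi; split => //; first exact: linear_flow_is_flow.
  split=> //; exists b^T; split=> //; exists 1; first exact: oner_neq0.
  by rewrite (_ : (fun i => _) = (fun i => b i 0))//; apply/funext => i; rewrite mxE mul1r.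
rewrite multiplier_groupE; last by rewrite -trmx0 (inj_eq trmx_inj).
apply/seteqP; split=> [alpha [f fa]|u].
  exact: flow_multiplier_integral Fring b0 bb fa.
exact: unit_multiplier.
Qed.
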